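(* Let $p$ be a prime and let $G$ be a non-abelian finite $p$-group. If $\operatorname{mci}(G)=p^k$ then $|G|\le p^{2k+2}$, unless $G\cong Q_8$. This bound is best possible.
   Context: For a non-abelian finite group $G$, the maximum centralizer index of $G$ is $$\operatorname{mci}(G)=\max\{\,|C_G(g):\langle g\rangle| \;:\; g\in G\smallsetminus Z(G)\,\},$$ where $C_G(g)$ is the centralizer of $g$ in $G$ and $Z(G)$ is the centre of $G$. If $G$ is a non-abelian finite $p$-group then $\operatorname{mci}(G)$ divides $|G|$, so it is a power $p^k$ of $p$ for some integer $k\ge 0$. $Q_8$ denotes the quaternion group of order $8$. *)

(* Defs.v *)
From mathcomp Require Import all_boot all_fingroup all_solvable.

Set Implicit Arguments.
Unset Strict Implicit.
Unset Printing Implicit Defensive.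

Local Open Scope group_scope.

(* The range is nonempty exactly when G is not abelian; for abelian G the value
   is the junk value 0. *)
Definition mci (gT : finGroupType) (G : {group gT}) : nat :=
  (\max_(g in G :\: 'Z(G)) #|'C_G[g] : <[g]>|)%N.

(* Main.v *)
Require Import Defs.
From HB Require Import structures.
From mathcomp Require Import all_boot all_order all_algebra all_fingroup.
From mathcomp Require Import all_solvable all_field all_character.
From mathcomp Require Import ring zify.

(* Write Z for the centre, so that |C(g)| <= p^k #[g] for all g outside Z, and
   in particular p|Z| <= p^k #[g].  Let p^n be 4 if p = 2 and p otherwise.

   If some x outside Z has x^(p^n) = 1, then such an element g can be found in
   the second centre with g^p in Z; its commutators lie in Omega_1(Z), whence
   |G| <= |C(g)| |Omega_1(Z)| <= p^(k + n) |Omega_1(Z)|.  For odd p this is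
   enough.  For p = 2 the bound can only fail if Z is elementary abelian, squares
   are central, [x, G] = Z for all x outside Z, and |G| = 2 |Z|^2.  For each
   nontrivial character chi of Z the sum of chi(x^2) over G then squares to
   |G| |Z|, while these |Z| - 1 sums add up to -|Z|^2; hence |Z| = 2 m^2 with m
   odd, so |Z| = 2 and G is Q_8.

   Otherwise a^p = b^p implies (a^-1 b)^p = 1.  Let E/Z, of order p^e, be the
   group of cosets x Z with x^p in Z; let h be an element of least order p^s
   outside Z.  Counting fibres of power maps gives |G : C(h)| <= p^e and
   |Z| >= p^(e(s - 1)), and e >= 2.  These estimates miss the bound by at most
   one factor p, which is gained from G = E, or from an x outside E, which
   centralises an element of E \ Z without lying in E.

   Equality is attained by the semidirect product of two cyclic groups of order
   p^(k + 1) in which [x, y] = x^(p^k). *)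

Set Implicit Arguments.
Unset Strict Implicit.
Unset Printing Implicit Defensive.

Local Open Scope group_scope.

(** * Fibre counting, a binomial divisibility and indices in p-groups *)

Lemma leq_card_fibers (aT rT : finType) (f : aT -> rT) (A : {set aT}) m :
    (forall x, x \in A -> #|[set y in A | f y == f x]| <= m) ->
  #|A| <= m * #|f @: A|.
Proof.
move=> leAm; rewrite -sum1_card (partition_big_imset f) /= mulnC -sum_nat_const.
by apply: leq_sum => _ /imsetP[x Ax ->]; rewrite sum1dep_card leAm.
Qed.

(** ['C(p ^ n, 2)] is the exponent of the commutator in the p^n-th power of a product. Since
    ['C(2, 2)] is 1, the prime 2 needs the exponent 4. *)
Lemma dvdn_bin2_pexp p n : prime p -> 2 < p ^ n -> p %| 'C(p ^ n, 2).
Proof.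
move=> p_pr; case: n => [|n] lt2q //; have [p2 | p_odd] := even_prime p_pr.
  case: n lt2q => [|n] lt2q; first by rewrite p2 in lt2q.
  by rewrite bin2 p2 expnS -mulnA mul2n doubleK expnS -mulnA dvdn_mulr.
by rewrite bin2odd ?oddX ?p_odd ?orbT // expnS -mulnA dvdn_mulr.
Qed.

Lemma leq_card_pgroup_proper (gT : finGroupType) (p : nat) (A B : {group gT}) x :
    p.-group B -> A \subset B -> x \in B -> x \notin A -> p * #|A| <= #|B|.
Proof.
move=> pB sAB Bx nAx; rewrite -(Lagrange sAB) mulnC leq_mul2l.
have [n oBA] := p_natP (pnat_dvd (dvdn_indexg B A) pB).
apply/orP; right; rewrite oBA; case: n oBA => [|n] oBA; last first.
  by have:= indexg_gt0 B A; rewrite oBA expnS muln_gt0 => /andP[_]; apply: leq_pmulr.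
by case/negP: nAx; apply: (subsetP (_ : B \subset A)) => //; rewrite -indexg_eq1 oBA.
Qed.

(** * Central commutators and lower bounds for centralizers in a p-group *)

Section PGroup.

Variables (gT : finGroupType) (G : {group gT}) (p : nat).
Hypotheses (p_pr : prime p) (pG : p.-group G).
Implicit Types (x y z t : gT) (M : {group gT}).
Local Notation Z := 'Z(G).

Lemma center_mem z : z \in Z -> z \in G.
Proof. exact: (subsetP (center_sub G)). Qed.

Lemma centralC x z : x \in G -> z \in Z -> commute x z.
Proof. by move=> Gx Zz; apply: (centerC Gx). Qed.

Lemma expMg_centralR i x y : x \in G -> y \in G -> [~ x, y] \in Z ->
  (y * x) ^+ i = y ^+ i * x ^+ i * [~ x, y] ^+ 'C(i, 2).
Proof.
by move=> Gx Gy Zxy; apply: expMg_Rmul; apply: centralC.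
Qed.

Lemma expMg_smallR i x y : x \in G -> y \in G -> [~ x, y] \in Z ->
  [~ x, y] ^+ p = 1 -> p %| 'C(i, 2) -> (y * x) ^+ i = y ^+ i * x ^+ i.
Proof.
move=> Gx Gy Zxy xyp /dvdnP[m eqm].
by rewrite expMg_centralR // eqm mulnC expgM xyp expg1n mulg1.
Qed.

Lemma commg_expg_central x y : x \in G -> y \in G -> [~ x, y] \in Z ->
  x ^+ p \in Z -> [~ x, y] ^+ p = 1.
Proof.
move=> Gx Gy Zxy Zxp; rewrite -commXg; last exact: centralC.
exact/eqP/commgP/commute_sym/centralC.
Qed.

Lemma last_noncentral_expg x : x \in G -> x \notin Z ->
  exists i, x ^+ (p ^ i) \notin Z /\ (x ^+ (p ^ i)) ^+ p \in Z.
Proof.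
move=> Gx nZx; have [n ox] := p_natP (mem_p_elt pG Gx).
have exn : exists n, x ^+ (p ^ n) \in Z by exists n; rewrite -ox expg_order group1.
case: (ex_minnP exn) => [[|i]]; first by rewrite expg1 (negPf nZx).
move=> Zi mini; exists i; rewrite -expgM -expnSr; split=> //.
by apply/negP => /mini; rewrite ltnn.
Qed.

(* Climb a subnormal chain from <x>Z to G: in each step the admissible elements
   of the second centre form a normal subgroup, whose image in the quotient by Z
   meets the centre. *)
Lemma second_center_small_elt n x : 2 < p ^ n -> x \in G -> x \notin Z ->
    x ^+ (p ^ n) = 1 ->
  exists g, [/\ g \in G, g \notin Z, g ^+ (p ^ n) = 1, g ^+ p \in Z
              & forall t, t \in G -> [~ g, t] \in Z].
Proof.
move=> lt2q; set c := (p ^ n)%N => Gx nZx xc.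
have [i [nZxi Zxip]] := last_noncentral_expg Gx nZx.
have{Gx} Gxi: x ^+ (p ^ i) \in G by rewrite groupX.
have{xc nZx} xic: (x ^+ (p ^ i)) ^+ c = 1 by rewrite expgAC xc expg1n.
move: (x ^+ _) nZxi Zxip Gxi xic => {i} {}x nZx Zxp Gx xc.
suffices IH m M : #|M| <= m -> Z \subset M -> M \subset G -> x \in M ->
    exists g, [/\ g \in M, g \notin Z, g ^+ c = 1, g ^+ p \in Z
              & forall t, t \in M -> [~ g, t] \in Z].
  exact: (IH #|G| G (leqnn _) (center_sub G)).
elim: m M => [|m IHm] M leMm sZM sMG Mx; first by rewrite leqNgt cardG_gt0 in leMm.
have sKM: <[x]> <*> Z \subset M by rewrite join_subG cycle_subG Mx.
case: (maximal_exists sKM) => [defM | [N maxN sKN]].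
  exists x; split=> // t; rewrite -defM => Kt.
  have cxK: <[x]> <*> Z \subset 'C[x].
    rewrite join_subG cycle_subG cent1id /=.
    by apply/subsetP=> z Zz; apply/cent1P/commute_sym/centralC.
  suffices -> : [~ x, t] = 1 by apply: group1.
  by apply/eqP/commgP/cent1P; rewrite cent1C (subsetP cxK).
have pM := pgroupS sMG pG; have /andP[sNM nNM] := p_maximal_normal pM maxN.
have sZN: Z \subset N by apply: subset_trans sKN; apply: joing_subr.
have Nx: x \in N by rewrite (subsetP sKN) // mem_gen // inE cycle_id.
have leNm: #|N| <= m.
  by rewrite -ltnS (leq_trans _ leMm) // proper_card // (maxgroupp maxN).
have [y [Ny nZy yc Zyp ZyN]] := IHm N leNm sZN (subset_trans sNM sMG) Nx.
(* The last clause says that [v] is central in [N] modulo [Z]. Products stay in [F] because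
   commutators have order dividing p and p divides ['C(c, 2)]. *)
pose F := [set v in N | [&& v ^+ p \in Z, v ^+ c == 1
                           & [forall t in N, [~ v, t] \in Z]]].
have sNG := subset_trans sNM sMG.
have FP v : reflect [/\ v \in N, v ^+ p \in Z, v ^+ c = 1
                        & forall t, t \in N -> [~ v, t] \in Z] (v \in F).
  apply: (iffP setIdP) => [[Nv /and3P[Zv /eqP vc /forall_inP ZvN]] // | ].
  by case=> Nv Zv vc ZvN; split=> //; apply/and3P; split=> //; [apply/eqP | apply/forall_inP].
have nZ t v : t \in G -> v \in Z -> v ^ t \in Z.
  by move=> Gt; rewrite memJ_norm // (subsetP (normal_norm (center_normal G))).
have gF: group_set F.
  apply/group_setP; split.
    by apply/FP; split=> *; rewrite ?expg1n ?comm1g ?group1.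
  move=> v w /FP[Nv Zv vc ZvN] /FP[Nw Zw wc ZwN].
  have [Gv Gw] := (subsetP sNG v Nv, subsetP sNG w Nw).
  apply/FP; split; first exact: groupM.
  - rewrite expMg_centralR ?ZwN //.
    by apply: groupM; [apply: groupM | apply/groupX/ZwN].
  - rewrite expMg_smallR ?ZwN ?vc ?wc ?mulg1 //.
      by rewrite commg_expg_central ?ZwN.
    exact: dvdn_bin2_pexp.
  by move=> t Nt; rewrite commMgJ groupM ?ZwN // nZ ?ZvN.
have nFM: Group gF <| M.
  apply/andP; split; first by apply/subsetP=> v /FP[Nv _ _ _]; apply: (subsetP sNM).
  apply/subsetP=> t Mt; rewrite inE; apply/subsetP=> _ /imsetP[v /FP[Nv Zv vc ZvN] ->].
  have Gt := subsetP sMG t Mt.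
  apply/FP; split; first by rewrite memJ_norm ?(subsetP nNM).
  - by rewrite -conjXg nZ.
  - by rewrite -conjXg vc conj1g.
  move=> s Ns; rewrite -[s](conjgKV t) -conjRg nZ // ZvN //.
  by rewrite memJ_norm // groupV (subsetP nNM).
have nZM: M \subset 'N(Z) := subset_trans sMG (normal_norm (center_normal G)).
have Fy: y \in Group gF by apply/FP.
have ntF: Group gF / Z != 1.
  apply/trivgPn; exists (coset Z y); first exact: mem_quotient.
  by apply: contra nZy => /eqP/coset_idr; apply; apply: (subsetP nZM); apply: (subsetP sNM).
have [_ /setIP[/morphimP[v nZv Fv ->] /centerP[_ cvM]] ntv] := trivgPn _ (meet_center_nil (pgroup_nil (quotient_pgroup Z pM))
   (quotient_normal Z nFM) ntF).
have /FP[Nv Zv vc _] := Fv.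
exists v; split=> //; first exact: (subsetP sNM).
  by apply: contra ntv => Z_v; apply/eqP/coset_id.
move=> t Mt; have nZt := subsetP nZM t Mt.
apply: coset_idr; rewrite ?groupR // morphR //=.
exact/eqP/commgP/cvM/mem_quotient.
Qed.

(** Since [g ^ t = g * [~ g, t]], the class of [g] lies in the coset [g *: C]. *)
Lemma card_leq_cent1 g (C : {set gT}) : g \in G ->
  (forall t, t \in G -> [~ g, t] \in C) -> #|G| <= #|'C_G[g]| * #|C|.
Proof.
move=> Gg CgG; rewrite -(Lagrange (subsetIl G 'C[g])) index_cent1 leq_mul2l.
apply/orP; right; rewrite -(card_lcoset C g); apply: subset_leq_card.
by apply/subsetP=> _ /imsetP[t Gt ->]; rewrite mem_lcoset CgG.
Qed.

Lemma leq_card_cent1 g : g \in G -> g \notin Z -> p * #|Z| <= #|'C_G[g]|.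
Proof.
move=> Gg nZg; have sZC: Z \subset 'C_G[g].
  by rewrite subsetI center_sub; apply/subsetP=> z Zz; apply/cent1P/commute_sym/centralC.
apply: (leq_card_pgroup_proper _ sZC _ nZg).
  by apply: pgroupS pG; apply: subsetIl.
by rewrite inE Gg cent1id.
Qed.

(** Both inclusions in the chain Z, <g>Z, C(g) are proper: p-th powers of elements of <g>Z are
    central, so [x] lies outside <g>Z. *)
Lemma leq_card_cent1_sqr g x : g \in G -> g \notin Z -> g ^+ p \in Z ->
  x \in 'C_G[g] -> x ^+ p \notin Z -> p * (p * #|Z|) <= #|'C_G[g]|.
Proof.
move=> Gg nZg Zgp Cx nZxp; have sKC: <[g]> <*> Z \subset 'C_G[g].
  rewrite join_subG cycle_subG inE Gg cent1id subsetI center_sub.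
  by apply/subsetP=> z Zz; apply/cent1P/commute_sym/centralC.
have pC: p.-group 'C_G[g] by apply: pgroupS pG; apply: subsetIl.
have cgZ: <[g]> \subset 'C(Z) 
  by rewrite centsC (subset_trans (subsetIr _ _)) // centS ?cycle_subG.
have nKx: x \notin <[g]> <*> Z.
  apply: contra nZxp; rewrite cent_joinEr; last by rewrite centsC.
  case/mulsgP=> _ z /cycleP[i ->] Zz ->.
  rewrite expgMn; last exact: (centralC (groupX _ Gg)).
  by rewrite expgAC; apply: groupM; apply: groupX.
apply: leq_trans (leq_card_pgroup_proper pC sKC Cx nKx); rewrite leq_mul2l.
apply/orP; right; apply: (leq_card_pgroup_proper _ (joing_subr _ _) _ nZg).
  exact: pgroupS sKC pC.
by rewrite mem_gen // inE cycle_id.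
Qed.

End PGroup.

(** * Groups in which x^(p^n) = 1 forces x to be central *)

Section SmallCentral.

Variables (gT : finGroupType) (G : {group gT}) (p n : nat).
Hypotheses (p_pr : prime p) (pG : p.-group G) (lt2q : 2 < p ^ n).
Local Notation Z := 'Z(G).
Hypothesis small_central : forall x, x \in G -> x ^+ (p ^ n) = 1 -> x \in Z.
Implicit Types a b x y g : gT.

Lemma expgp1_central x : x \in G -> x ^+ p = 1 -> x \in Z.
Proof.
move=> Gx xp; apply: small_central => //; case: n lt2q => // m _.
by rewrite expnS expgM xp expg1n.
Qed.

Lemma commg_invr a b : a \in G -> [~ a, b] \in Z -> [~ b, a^-1] = [~ a, b].
Proof.
move=> Ga Zab; rewrite -[RHS](mulgK a) -(centralC Ga Zab).
by rewrite !commgEl !conjgE invgK !mulgA mulgV mul1g.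
Qed.

(* Induction on <a, b>: the pair a, a^b also has equal p-th powers and generates
   a smaller group, so that [a, b] has order dividing p and is central. *)
Lemma eq_expgp a b : a \in G -> b \in G -> a ^+ p = b ^+ p ->
  (a^-1 * b) ^+ p = 1.
Proof.
suffices IH m : #|<<[set a; b]>>| <= m -> a \in G -> b \in G ->
    a ^+ p = b ^+ p -> (a^-1 * b) ^+ p = 1 by apply: IH.
elim: m a b => [|m IHm] a b; first by rewrite leqNgt cardG_gt0.
move=> leHm Ga Gb eqab.
have [cab | ncab] := boolP (b \in 'C[a]).
  rewrite expgMn; last by apply/commute_sym/commuteV/cent1P.
  by rewrite expVgn eqab mulVg.
have sHG: <<[set a; b]>> \subset G by rewrite gen_subG subUset !sub1set Ga.
have Ha: a \in <<[set a; b]>> by rewrite mem_gen // !inE eqxx.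
have Hb: b \in <<[set a; b]>> by rewrite mem_gen // !inE eqxx orbT.
have /maximal_exists[defH | [M maxM]] : <[a]> \subset <<[set a; b]>>.
- by rewrite cycle_subG.
- case/negP: ncab; move: Hb; rewrite -defH => /cycleP[i ->].
  by apply/cent1P/commute_sym/commuteX.
rewrite cycle_subG => Ma.
have /andP[sMH nMH] := p_maximal_normal (pgroupS sHG pG) maxM.
have Mab: a ^ b \in M by rewrite memJ_norm // (subsetP nMH).
have abp: [~ a, b] ^+ p = 1.
  rewrite commgEl IHm ?groupJ //; last by rewrite -conjXg eqab conjgE -expgSr expgS mulKg.
  rewrite -ltnS (leq_trans _ leHm) //; apply: leq_ltn_trans (proper_card (maxgroupp maxM)).
  by rewrite subset_leq_card // gen_subG subUset !sub1set Ma.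
have Zab: [~ a, b] \in Z by rewrite expgp1_central ?groupR.
(* If a^-1 b is central, then [a] and [b] commute after all. It is central because the commutator
   term in its p^n-th power vanishes. *)
case/cent1P: ncab; suffices Zc: a^-1 * b \in Z.
  by rewrite -[b](mulKVg a); apply: commute_sym; apply: commuteM; [exact: erefl | exact: centralC Ga Zc].
apply: small_central; first by rewrite groupM ?groupV.
rewrite (@expMg_smallR _ G p) ?groupV ?commg_invr ?dvdn_bin2_pexp //.
case: n lt2q => // m' _.
by rewrite expnS !expgM expVgn eqab -expgMn ?mulVg ?expg1n //; apply/commute_sym/commuteV.
Qed.

Lemma eq_expgp_central a b : a \in G -> b \in G -> a ^+ p = b ^+ p ->
  a^-1 * b \in Z.
Proof.
by move=> Ga Gb eqab; rewrite expgp1_central ?eq_expgp // groupM ?groupV.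
Qed.

(** [a ^+ p] differs from [b ^+ p] by a central factor, so it commutes with [b]; hence [a] and
    [a ^ b] have equal p-th powers. *)
Lemma commg_eq_expgp_mod a b : a \in G -> b \in G ->
  (a ^+ p)^-1 * b ^+ p \in Z -> [~ a, b] \in Z /\ [~ a, b] ^+ p = 1.
Proof.
move=> Ga Gb Zab; have cab: commute b (a ^+ p).
  rewrite -[a ^+ p]invgK; apply: commuteV.
  rewrite -[_^-1](mulgK (b ^+ p)); apply: commuteM; first exact: (centralC Gb).
  exact/commuteV/commuteX.
have eqab: a ^+ p = (a ^ b) ^+ p by rewrite -conjXg conjgE -cab mulKg.
by rewrite commgEl; split; [apply: eq_expgp_central | apply: eq_expgp]; rewrite ?groupJ.
Qed.

Lemma expgp_mod a b : a \in G -> b \in G ->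
  (a ^+ p)^-1 * b ^+ p \in Z -> (a^-1 * b) ^+ p \in Z.
Proof.
move=> Ga Gb Zab; have [Zc cp] := commg_eq_expgp_mod Ga Gb Zab.
have ec := commg_invr Ga Zc.
rewrite (@expMg_centralR _ G) ?groupV ?ec // expVgn.
by apply: groupM => //; apply: groupX.
Qed.

Definition center_roots := [set x in G | x ^+ p \in Z].

Lemma center_rootsP x : reflect (x \in G /\ x ^+ p \in Z) (x \in center_roots).
Proof. exact: setIdP. Qed.

Lemma center_roots_group_set : group_set center_roots.
Proof.
have rV x : x \in center_roots -> x^-1 \in center_roots.
  by case/center_rootsP=> Gx Zx; apply/center_rootsP; rewrite expVgn !groupV.
apply/group_setP; split; first by apply/center_rootsP; rewrite expg1n; split; apply: group1.
move=> x y /rV /center_rootsP[Gx Zx] /center_rootsP[Gy Zy].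
apply/center_rootsP; rewrite -[x]invgK; split; first by rewrite groupM // groupV.
by apply: expgp_mod => //; apply: groupM => //; rewrite groupV.
Qed.
Canonical center_roots_group := Group center_roots_group_set.
Local Notation E := center_roots.

Lemma center_roots_sub : E \subset G.
Proof. by apply/subsetP=> x /center_rootsP[]. Qed.

Lemma center_sub_roots : Z \subset E.
Proof.
by apply/subsetP=> z Zz; apply/center_rootsP; rewrite center_mem // groupX.
Qed.

Lemma commg_roots x t : x \in E -> t \in G -> [~ x, t] \in Z /\ [~ x, t] ^+ p = 1.
Proof.
case/center_rootsP=> Gx Zx Gt.
have eqxt: x ^+ p = (x ^ t) ^+ p.
  by rewrite -conjXg conjgE -(centralC Gt Zx) mulKg.
by rewrite commgEl; split; [apply: eq_expgp_central | apply: eq_expgp]; rewrite ?groupJ.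
Qed.

(** The map from x to the coset x^p Z has fibres inside cosets of E, and its values lie in C(g)/Z
    because [g, x]^p = 1 gives [g, x^p] = 1. *)
Lemma card_cent1_roots g : g \in E -> #|G| * #|Z| <= #|'C_G[g]| * #|E|.
Proof.
move=> Eg; have Gg := subsetP center_roots_sub g Eg.
have sZC: Z \subset 'C_G[g].
  rewrite subsetI center_sub; apply/subsetP=> z Zz.
  exact/cent1P/commute_sym/(centralC Gg).
pose f x := x ^+ p *: Z.
have lefE x : x \in G -> #|[set y in G | f y == f x]| <= #|E|.
  move=> Gx; rewrite -(card_lcoset E x); apply: subset_leq_card.
  apply/subsetP=> y /setIdP[Gy /eqP eqf].
  rewrite mem_lcoset; apply/center_rootsP; split; first by rewrite groupM ?groupV.
  by apply: expgp_mod => //; rewrite -mem_lcoset -[_ *: _]eqf lcoset_refl.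
apply: leq_trans (leq_mul (leq_card_fibers lefE) (leqnn _)) _.
rewrite -mulnA mulnC leq_mul2r; apply/orP; right.
rewrite -(Lagrange sZC) mulnC leq_mul2l -card_lcosets.
apply/orP; right; apply/subset_leq_card/subsetP=> _ /imsetP[x Gx ->].
apply/lcosetsP; exists (x ^+ p) => //; rewrite inE groupX //=; apply/cent1P.
have [Zc cp] := commg_roots Eg Gx.
apply/commute_sym/commgP/eqP; rewrite commgX //.
exact: (centralC Gx).
Qed.

(** On E the map from x to x^(p^j) has fibres inside cosets of Omega_j(Z). As x^p is in Z, its image
    lies in Mho^(j-1)(Z), of order |Z| / |Omega_(j-1)(Z)|. *)
Lemma card_Ohm_center_step j : 0 < j ->
    (forall x, x \in G -> x ^+ (p ^ j) = 1 -> x \in Z) ->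
  #|E| * #|'Ohm_(j.-1)(Z)| <= #|'Ohm_j(Z)| * #|Z|.
Proof.
case: j => // j _ cGj /=; pose f x := x ^+ (p ^ j.+1).
have pZ : p.-group Z := pgroupS (center_sub G) pG.
have cZZ := center_abelian G.
have lefE x : x \in E -> #|[set y in E | f y == f x]| <= #|'Ohm_j.+1(Z)|.
  move=> Ex; have [Gx Zx] := center_rootsP x Ex.
  rewrite -(card_lcoset 'Ohm_j.+1(Z) x); apply: subset_leq_card.
  apply/subsetP=> y /setIdP[Ey /eqP eqf].
  have [Gy Zy] := center_rootsP y Ey.
  have fxy: (x^-1 * y) ^+ (p ^ j.+1) = 1.
    (* The exponent p may be 2, where the commutator term need not vanish, so [eq_expgp] serves
       there; higher powers of p exceed 2. *)
    case: j @f cGj eqf => [|j] f cGj eqf; first by rewrite expn1 eq_expgp // -[RHS]eqf.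
    have [Zc cp] := commg_roots Ex Gy.
    have ec := commg_invr Gx Zc.
    rewrite (@expMg_smallR _ G p) ?groupV ?ec // ?expVgn; first by rewrite [y ^+ _]eqf mulVg.
    apply: dvdn_bin2_pexp => //; rewrite !expnS.
    apply: leq_trans (leq_mul (prime_gt1 p_pr) (leq_mul (prime_gt1 p_pr) (_ : 0 < _))) => //.
    by rewrite expn_gt0 prime_gt0.
  rewrite mem_lcoset (OhmEabelian pZ) ?(abelianS (Ohm_sub _ _)) //.
  by apply/setIP; split; [rewrite cGj ?groupM ?groupV | rewrite inE fxy].
rewrite -(mul_card_Ohm_Mho_abelian j cZZ) mulnCA mulnC leq_mul2l.
apply/orP; right.
apply: leq_trans (leq_card_fibers lefE) _; rewrite leq_mul2l.
apply/orP; right; rewrite (MhoEabelian j pZ) //; apply/subset_leq_card/subsetP.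
move=> _ /imsetP[x /center_rootsP[Gx Zx] ->].
by apply/imsetP; exists (x ^+ p); rewrite // /f expnS expgM.
Qed.
Lemma card_center_rootsE : #|E| = (#|Z| * #|E : Z|)%N.
Proof. by rewrite Lagrange ?center_sub_roots. Qed.

Lemma card_Ohm_center s j : (forall x, x \in G -> x ^+ (p ^ s) = 1 -> x \in Z) ->
  j <= s -> #|E : Z| ^ j <= #|'Ohm_j(Z)|.
Proof.
move=> cGs; elim: j => [|j IHj] ltjs; first by rewrite expn0 cardG_gt0.
have cGj x : x \in G -> x ^+ (p ^ j.+1) = 1 -> x \in Z.
  by move=> Gx xj; rewrite cGs // -(subnKC ltjs) expnD expgM xj expg1n.
have:= card_Ohm_center_step (ltn0Sn j) cGj.
rewrite card_center_rootsE -mulnA mulnC leq_pmul2r ?cardG_gt0 //; apply: leq_trans.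
by rewrite expnS leq_mul2l IHj ?orbT // ltnW.
Qed.

(** Suppose |E : Z| is at most p. Each noncentral x has a noncentral power in E, which together with
    Z generates E, so x centralises E. Then E is central, although it contains noncentral
    elements. *)
Lemma index_center_roots_gt1 : ~~ abelian G ->
  exists e, #|E : Z| = (p ^ e)%N /\ 1 < e.
Proof.
move=> nabG; have pE := pgroupS center_roots_sub pG.
have [e oEZ] := p_natP (pnat_dvd (dvdn_indexg E Z) pE).
have EP x : x \in G -> x \notin Z -> exists2 i, x ^+ i \notin Z & x ^+ i \in E.
  move=> Gx nZx; have [i [nZxi Zxi]] := last_noncentral_expg pG Gx nZx.
  by exists (p ^ i)%N => //; apply/center_rootsP; rewrite groupX.
have [x0 Gx0 nZx0] : exists2 x, x \in G & x \notin Z.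
  by apply/subsetPn; apply: contra nabG => sGZ; apply: abelianS sGZ (center_abelian G).
have [i nZh Eh] := EP x0 Gx0 nZx0; set h := x0 ^+ i in nZh Eh.
have Gh := subsetP center_roots_sub h Eh.
exists e; split=> //; rewrite ltnNge; apply: contra nZh => le_e1.
rewrite -[h \in Z]/(h \in [group of Z]); apply/centerP; split=> // x Gx.
have [Zx | nZx] := boolP (x \in Z); first exact: (centralC Gh).
have [j nZxj Exj] := EP x Gx nZx.
have sZ : Z \subset 'C_E[x].
  rewrite subsetI center_sub_roots; apply/subsetP=> z Zz.
  exact/cent1P/commute_sym/(centralC Gx).
have: 'C_E[x] == E :> {set gT}.
  rewrite eqEcard subsetIl card_center_rootsE oEZ mulnC.
  apply: (@leq_trans (p * #|Z|)).
    by rewrite leq_mul2r -{2}[p]expn1 leq_pexp2l ?prime_gt0 ?orbT.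
  apply: leq_card_pgroup_proper sZ _ nZxj; first exact: pgroupS (subsetIl _ _) pE.
  by rewrite inE Exj; apply/cent1P/commute_sym/commuteX.
by move/eqP/setP/(_ h); rewrite inE Eh => /cent1P.
Qed.

Lemma card_leq_small_central k : ~~ abelian G ->
    (forall g, g \in G -> g \notin Z -> #|'C_G[g]| <= p ^ k * #[g]) ->
  #|G| <= p ^ (2 * k + 2).
Proof.
move=> nabG leC; have p_gt1 := prime_gt1 p_pr.
have [e [oEZ e_gt1]] := index_center_roots_gt1 nabG.
have [x0 Gx0 nZx0] : exists2 x, x \in G & x \notin Z.
  by apply/subsetPn; apply: contra nabG => sGZ; apply: abelianS sGZ (center_abelian G).
have P0: (x0 \in G) && (x0 \notin Z) by rewrite Gx0.
case: (@arg_minnP _ x0 (fun x => (x \in G) && (x \notin Z)) (fun x => #[x]) P0).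
move=> h /andP[Gh nZh] minh {x0 Gx0 nZx0 P0}.
have [s oh] := p_natP (mem_p_elt pG Gh).
(* From here on [h] has order p^(s+1): [s] is one less than the exponent of the least order. *)
case: s oh => [|s] oh.
  by case/negP: nZh; move/eqP: oh; rewrite order_eq1 => /eqP->.
have cGs x : x \in G -> x ^+ (p ^ s) = 1 -> x \in Z.
  move=> Gx xs; apply: contraT => nZx.
  have:= minh x; rewrite Gx nZx oh => /(_ isT)/leq_trans/(_ (dvdn_leq _ _)).
  move/(_ (p ^ s)%N); rewrite leq_exp2l // ltnn => -> //; last first.
    by rewrite order_dvdn xs.
  by rewrite expn_gt0 prime_gt0.
have s_gt0: 0 < s.
  by case: s oh cGs => // oh _; case/negP: nZh; rewrite expgp1_central // -[RHS](expg_order h) oh.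
have Eh: h \in E.
  by apply/center_rootsP; rewrite Gh cGs ?groupX // -expgM -expnS -oh expg_order.
have pZ : p.-group Z := pgroupS (center_sub G) pG.
have [u oZ] := p_natP pZ.
have leG: #|G| <= p ^ (k + s.+1 + e).
  have:= card_cent1_roots Eh; rewrite card_center_rootsE mulnCA mulnC leq_pmul2l ?cardG_gt0 //.
  by move/leq_trans; apply; rewrite oEZ expnD leq_mul2r expnD -oh leC ?orbT.
have leu: u <= k + s.
  have:= leq_trans (leq_card_cent1 pG Gh nZh) (leC h Gh nZh).
  by rewrite oZ oh -expnS -expnD leq_exp2l // addnS.
have leOhm: p ^ (e * s) <= #|'Ohm_s(Z)|.
  by have:= card_Ohm_center cGs (leqnn s); rewrite oEZ -expnM.
have leesu: e * s <= u.
  by rewrite -(leq_exp2l _ _ p_gt1) -oZ (leq_trans leOhm) // subset_leq_card ?Ohm_sub.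
(* This is (e - 2)(s - 1) >= 0. *)
have les: e + 2 * s <= e * s + 2 by clear - e_gt1 s_gt0; nia.
have [sGE | /subsetPn[x Gx nEx]] := boolP (G \subset E).
  have: #|G| <= p ^ (u + e).
    by rewrite (leq_trans (subset_leq_card sGE)) // card_center_rootsE oZ oEZ expnD.
  move/leq_trans; apply; rewrite leq_exp2l //.
  by clear - leu leesu les; lia.
have nZx: x \notin Z by apply: contra nEx => Zx; apply: (subsetP center_sub_roots).
have [i [nZy Zyp]] := last_noncentral_expg pG Gx nZx.
set y := x ^+ (p ^ i) in nZy Zyp.
have Gy : y \in G by rewrite groupX.
(* In the first case C(y) contains [x], whose p-th power is not central, and u <= k + s improves by
   one. In the second, y^p lies in Z outside Omega_s(Z), and e s <= u improves by one. *)
have [ys | nys] := eqVneq (y ^+ (p ^ s.+1)) 1.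
  have nZxp : x ^+ p \notin Z by apply: contra nEx => Zxp; apply/center_rootsP.
  have Cx : x \in 'C_G[y] by rewrite inE Gx; apply/cent1P/commuteX.
  have:= leq_trans (leq_card_cent1_sqr pG Gy nZy Zyp Cx nZxp) (leC y Gy nZy).
  move/leq_trans=> /(_ (p ^ k * p ^ s.+1))%N.
  rewrite leq_pmul2l ?expn_gt0 ?prime_gt0 // dvdn_leq ?expn_gt0 ?prime_gt0 ?order_dvdn ?ys //.
  move/(_ isT); rewrite oZ -!expnS -expnD leq_exp2l // => leu2.
  apply: leq_trans leG _; rewrite leq_exp2l //.
  by clear - leu2 leesu les; lia.
have: p * #|'Ohm_s(Z)| <= #|Z|.
  apply: (leq_card_pgroup_proper pZ (Ohm_sub _ _) Zyp).
  apply: contra nys; rewrite /= (OhmEabelian pZ) ?(abelianS (Ohm_sub _ _)) ?center_abelian //.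
  by case/setIP=> _; rewrite inE -expgM -expnS.
move=> leu2; have: p ^ (e * s).+1 <= p ^ u.
  by rewrite -oZ (leq_trans _ leu2) // expnS leq_mul2l leOhm orbT.
rewrite leq_exp2l // => leu3.
apply: leq_trans leG _; rewrite leq_exp2l //.
by clear - leu leu3 les; lia.
Qed.

End SmallCentral.

(** * Groups with central squares: quadratic character sums and the recognition of Q_8 *)

Lemma commg_sqr_mem (gT : finGroupType) (G H : {group gT}) x y :
  (forall z, z \in G -> z ^+ 2 \in H) -> x \in G -> y \in G -> [~ x, y] \in H.
Proof.
move=> sqrH Gx Gy; suffices ->: [~ x, y] = x ^- 2 * ((x * y^-1) ^+ 2 * y ^+ 2).
  apply: groupM; first by rewrite groupV sqrH.
  by apply: groupM; apply: sqrH => //; rewrite groupM ?groupV.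
by rewrite commgEl conjgE !expgS !expg0 !mulg1 invMg !mulgA !mulgKV.
Qed.

Section SquareCharacterSums.

Import GRing.Theory Num.Theory.
Local Open Scope ring_scope.
Local Open Scope group_scope.

Variables (gT : finGroupType) (G : {group gT}).
Local Notation Z := 'Z(G)%G.
Hypothesis sqrZ : forall x, x \in G -> x ^+ 2 \in Z.
Hypothesis Zsqr : forall z, z \in Z -> z ^+ 2 = 1.
Hypothesis sqr_central : forall x, x \in G -> x ^+ 2 = 1 -> x \in Z.
Hypothesis commZ : forall x z, x \in G -> x \notin Z -> z \in Z ->
  exists2 y, y \in G & [~ x, y] = z.
Hypothesis cardG : #|G| = (2 * #|Z| ^ 2)%N.
Hypothesis Z_even : ~~ odd #|Z|.

Let irr_lin i : 'chi[Z]_i \is a linear_char.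
Proof. by apply/char_abelianP/center_abelian. Qed.

Let commG x y : x \in G -> y \in G -> [~ x, y] \in Z.
Proof. exact: commg_sqr_mem. Qed.

Definition sqr_char_sum i := (\sum_(x in G) 'chi[Z]_i (x ^+ 2)%g)%R.

(* A Gauss sum: substitute y = x t in the double sum over x and y. *)
Lemma sqr_sqr_char_sum i : i != 0%R ->
  (sqr_char_sum i ^+ 2 = (#|G| * #|Z|)%:R)%R.
Proof.
move=> nz_i; have chiM := lin_charM (irr_lin i).
have [z0 Zz0 nchi] : exists2 z, z \in Z & 'chi[Z]_i z != 1%R.
  apply/exists_inP; rewrite -[X in is_true X]negbK negb_exists_in; apply: contra nz_i.
  move/forall_inP=> chi1; rewrite -irr_eq1; apply/eqP/cfun_inP=> z Zz.
  by rewrite cfun1E Zz; apply/eqP; rewrite -[_ == _]negbK chi1.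
(* Translation by some y with [t, y] = z0 multiplies the sum by chi(z0), which is not 1. *)
have inner t : t \in G -> t \notin Z -> (\sum_(x in G) 'chi[Z]_i [~ t, x]%g = 0)%R.
  move=> Gt nZt; have [y Gy ty] := commZ Gt nZt Zz0.
  set s := (\sum_(x in G) _)%R.
  have eqs : (s = 'chi[Z]_i z0 * s)%R.
    rewrite {1}/s (reindex_inj (mulIg y)) /= mulr_sumr.
    apply: eq_big => [x | x]; first by rewrite groupMr.
    move=> Gxy; have Gx : x \in G by rewrite groupMr in Gxy.
    rewrite commgMJ ty -chiM ?commG //; congr ('chi_i (_ * _)).
    have := centerC Gy (commG Gt Gx); rewrite /commute => cy.
    by rewrite conjgE -cy mulKg.
  apply/eqP; have: ((1 - 'chi[Z]_i z0) * s == 0)%R.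
    by rewrite mulrBl mul1r -eqs subrr.
  by rewrite mulf_eq0 subr_eq0 eq_sym (negPf nchi).
rewrite expr2 {1}/sqr_char_sum mulr_suml.
(* Here x^2 (x t)^2 = t^2 [t, x], because x^4 = 1. *)
transitivity (\sum_(x in G) \sum_(t in G) 'chi[Z]_i (t ^+ 2)%g * 'chi[Z]_i [~ t, x]%g)%R.
  apply: eq_bigr => x Gx; rewrite /sqr_char_sum mulr_sumr (reindex_inj (mulgI x)) /=.
  apply: eq_big => [t | t]; first by rewrite groupMl.
  rewrite groupMl // => Gt; rewrite -!chiM ?sqrZ ?commG ?groupM //.
  congr ('chi_i _); rewrite (@expMg_Rmul _ 2 t x).
  - have sqrK w : x ^+ 2 * (x ^+ 2 * w) = w.
      by rewrite mulgA (_ : x ^+ 2 * x ^+ 2 = 1) ?mul1g //; apply: (Zsqr (sqrZ Gx)).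
    by rewrite binn expg1 -(mulgA (x ^+ 2) (t ^+ 2)) sqrK.
  - exact: (centerC Gt (commG Gt Gx)).
  - exact: (centerC Gx (commG Gt Gx)).
rewrite exchange_big /= (bigID [in Z]) /= [X in (_ + X)%R]big1 ?addr0; last first.
  by move=> t /andP[Gt nZt]; rewrite -mulr_sumr inner ?mulr0.
rewrite (eq_bigl [in Z]) => [|t]; last by rewrite andbC andb_idr // => /(subsetP (center_sub G)).
rewrite (eq_bigr (fun _ => #|G|%:R)%R) => [|t Zt].
  by rewrite sumr_const natrM mulr_natr.
rewrite -mulr_sumr Zsqr // lin_char1 // mul1r -sumr_const.
apply: eq_bigr => x Gx; rewrite (_ : [~ t, x] = 1) ?lin_char1 //.
exact/eqP/commgP/commute_sym/(centerC Gx Zt).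
Qed.

(** Summing over all characters, the trivial one included, gives the regular character at x^2. It is
    |Z| for x in Z and 0 for other x, whose squares are not 1. *)
Lemma sum_sqr_char_sum : (\sum_i sqr_char_sum i = (#|Z| ^ 2)%:R)%R.
Proof.
rewrite exchange_big /=.
transitivity (\sum_(x in G) cfReg Z (x ^+ 2)%g)%R.
  apply: eq_bigr => x Gx; rewrite cfReg_sum sum_cfunE; apply: eq_bigr => i _.
  by rewrite cfunE lin_char1 // mul1r.
rewrite (bigID [in Z]) /= [X in (_ + X)%R]big1 ?addr0; last first.
  move=> t /andP[Gt nZt]; rewrite cfRegE; case: eqP => // t2.
  by rewrite sqr_central in nZt.
rewrite (eq_bigl [in Z]) => [|t]; last by rewrite andbC andb_idr // => /(subsetP (center_sub G)).
rewrite (eq_bigr (fun _ => #|Z|%:R)%R) => [|t Zt]; last by rewrite cfRegE Zsqr // eqxx.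
by rewrite sumr_const expnS expn1 natrM mulr_natr.
Qed.

(** The trivial character contributes |G| and the others c or -c, where c^2 = |G| |Z|. Squaring
    |Z|^2 - |G| = c (M' - M) gives |Z|^4 = 2 |Z|^3 d^2 with d = |M' - M|, which is odd because M +
    M' = |Z| - 1. *)
Lemma card_center_twice_odd_square : exists2 m, odd m & #|Z| = (2 * m ^ 2)%N.
Proof.
pose c := sqrtC (#|G| * #|Z|)%:R : algC; pose neg i := sqr_char_sum i != c.
have cS i : i != 0%R -> sqr_char_sum i = (c * (-1) ^+ neg i)%R.
  move=> nz_i; have: (sqr_char_sum i == c) || (sqr_char_sum i == - c)%R.
    by rewrite -eqf_sqr sqrtCK sqr_sqr_char_sum.
  by rewrite /neg; case: eqP => [-> | _ /eqP ->] /=; rewrite ?mulr1 ?mulrN1.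
pose M := #|[pred i : Iirr Z | (i != 0%R) && neg i]|.
pose M' := #|[pred i : Iirr Z | (i != 0%R) && ~~ neg i]|.
have oddN : odd (M + M').
  have := card_Iirr_abelian (center_abelian G); rewrite (cardD1 0%R) inE /= => defZ.
  move: Z_even; rewrite -defZ oddS negbK -(cardID neg); congr (odd (_ + _)).
    by apply: eq_card => i; rewrite !inE /= ?andbT.
  by apply: eq_card => i; rewrite !inE /= ?andbT andbC.
have: ((#|Z| ^ 2)%:R = #|G|%:R + c * (M'%:R - M%:R) :> algC)%R.
  rewrite -sum_sqr_char_sum (bigD1 0%R) //=; congr (_ + _)%R.
    rewrite /sqr_char_sum -sumr_const; apply: eq_bigr => x Gx.
    by rewrite irr0 cfun1E sqrZ.
  rewrite (eq_bigr _ cS) -mulr_sumr (bigID neg) /= addrC; congr (_ * (_ + _))%R.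
    rewrite (eq_bigr (fun _ => 1)%R) => [|i /andP[_ /negPf->]//].
    by rewrite sumr_const.
  rewrite (eq_bigr (fun _ => - 1)%R) => [|i /andP[_ ->]//].
  by rewrite sumr_const mulNrn.
move/(congr1 (fun x => x - #|G|%:R)%R); rewrite addrAC subrr add0r.
move/(congr1 (fun x => x ^+ 2)%R); rewrite exprMn sqrtCK => eqC.
pose d := ((M' - M) + (M - M'))%N.
have dE : ((M'%:R - M%:R) ^+ 2 = (d ^ 2)%:R :> algC)%R.
  rewrite /d; case/orP: (leq_total M M') => leM; rewrite (eqP leM) ?addn0 ?add0n natrX natrB //.
  by rewrite -sqrrN opprB.
have{eqC dE} /eqP : ((#|Z| ^ 2) ^ 2)%:R = (#|G| * #|Z| * d ^ 2)%:R :> algC.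
  rewrite [RHS]natrM -dE -eqC cardG natrX mulSn mul1n natrD opprD addrA subrr add0r.
  by rewrite sqrrN.
rewrite eqr_nat cardG => /eqP eqN; exists d; first by move: oddN; rewrite /d; lia.
have Z3 : (0 < #|Z| ^ 3)%N by rewrite expn_gt0 cardG_gt0.
apply/eqP; rewrite -(eqn_pmul2l Z3) -expnSr; apply/eqP; move: eqN; rewrite -expnM => ->.
by rewrite (expnSr _ 2) -!mulnA !(mulnCA 2).
Qed.

End SquareCharacterSums.

(** A power of 2 that is twice an odd square is 2, so |Z| = 2 and |G| = 8. Then Omega_1(G) = Z has
    order 2, which leaves only cyclic and quaternion groups. *)
Lemma isog_Q8_sqr (gT : finGroupType) (G : {group gT}) (Z := 'Z(G)) :
    2.-group G -> ~~ abelian G ->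
    (forall x, x \in G -> x ^+ 2 \in Z) -> (forall z, z \in Z -> z ^+ 2 = 1) ->
    (forall x, x \in G -> x ^+ 2 = 1 -> x \in Z) ->
    (forall x z, x \in G -> x \notin Z -> z \in Z ->
       exists2 y, y \in G & [~ x, y] = z) ->
    #|G| = (2 * #|Z| ^ 2)%N ->
  G \isog 'Q_8.
Proof.
move=> pG nabG sqrZ Zsqr sqr_central commZ oG.
have [a oZ] := p_natP (pgroupS (center_sub G) pG); rewrite -/Z in oZ.
have Z_even: ~~ odd #|Z|.
  rewrite oZ; case: a oZ => [|a] oZ; last by rewrite oddX.
  case/negP: nabG; apply/cyclic_abelian/prime_cyclic.
  by rewrite oG oZ.
have [m oddm oZm] := card_center_twice_odd_square sqrZ Zsqr sqr_central commZ oG Z_even.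
have oZ2: #|Z| = 2.
  suffices m1: m = 1%N by rewrite [LHS]oZm m1.
  have: 2.-nat m.
    by apply: (@pnat_dvd _ (2 ^ a)); rewrite ?pnatX ?pnat_id // -oZ [#|Z|]oZm dvdn_mull ?dvdn_mulr.
  case/p_natP=> [[|b]] // eqm.
  by rewrite eqm oddX in oddm.
have oG8 : #|G| = 8 by rewrite oG oZ2.
have ntG : G :!=: 1 by rewrite -cardG_gt1 oG8.
have defOhm : 'Ohm_1(G) = Z.
  apply/eqP; rewrite eqEsubset (OhmE 1 pG) gen_subG sub_gen ?andbT.
    by apply/subsetP=> x /setIP[Gx]; rewrite inE => /eqP; apply: sqr_central.
  apply/subsetP=> z Zz; apply/setIP; split; first exact: (subsetP (center_sub G) z Zz).
  by rewrite inE Zsqr.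
have /(prime_Ohm1P pG ntG) : #|'Ohm_1(G)| = 2 by rewrite defOhm.
case/orP=> [/cyclic_abelian cGG | ]; first by rewrite cGG in nabG.
case/andP=> _ /eqP/quaternion_classP[n n_gt2 isoG].
have /eqP := card_isog isoG; rewrite oG8 card_quaternion // -[8]/(2 ^ 3)%N eqn_exp2l // => /eqP en.
by rewrite -en in isoG.
Qed.

(** * The bound when some element of small order is not central *)

Section SmallNoncentral.

Variables (gT : finGroupType) (G : {group gT}) (p k : nat).
Local Notation Z := 'Z(G).
Hypotheses (p_pr : prime p) (pG : p.-group G) (nabG : ~~ abelian G).
Hypothesis leC :
  forall g, g \in G -> g \notin Z -> #|'C_G[g]| <= p ^ k * #[g].

Let leC_order g n : g \in G -> g \notin Z -> g ^+ n = 1 -> 0 < n ->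
  #|'C_G[g]| <= p ^ k * n.
Proof.
move=> Gg nZg gn n_gt0; apply: leq_trans (leC Gg nZg) _.
by rewrite leq_mul2l dvdn_leq ?orbT // order_dvdn gn.
Qed.

Lemma card_leq_Ohm1_center n x : 2 < p ^ n ->
    x \in G -> x \notin Z -> x ^+ (p ^ n) = 1 ->
  #|G| <= p ^ (k + n) * #|'Ohm_1(Z)| /\ p * #|Z| <= p ^ (k + n).
Proof.
move=> lt2q Gx nZx xn; have pZ := pgroupS (center_sub G) pG.
have [g [Gg nZg gn Zgp Zg]] := second_center_small_elt p_pr pG lt2q Gx nZx xn.
have leCg : #|'C_G[g]| <= p ^ (k + n).
  by rewrite expnD leC_order // expn_gt0 prime_gt0.
split; last exact: leq_trans (leq_card_cent1 pG Gg nZg) leCg.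
apply: leq_trans (leq_mul leCg (leqnn _)); apply: card_leq_cent1 => // t Gt.
rewrite (OhmEabelian pZ) ?(abelianS (Ohm_sub _ _)) ?center_abelian //.
apply/setIP; split; first exact: Zg.
by rewrite inE expn1 (commg_expg_central Gg Gt (Zg t Gt) Zgp).
Qed.

Lemma card_leq_small_noncentral_odd x : odd p ->
  x \in G -> x \notin Z -> x ^+ p = 1 -> #|G| <= p ^ (2 * k + 2).
Proof.
move=> odd_p Gx nZx xp.
have p_gt2 : 2 < p ^ 1 by rewrite expn1 odd_prime_gt2.
have [leG leZ] := card_leq_Ohm1_center p_gt2 Gx nZx xp.
apply: leq_trans leG _; rewrite (_ : 2 * k + 2 = k + 1 + (k + 1))%N; last by rewrite addnn -mul2n mulnDr.
rewrite (expnD p (k + 1) (k + 1)) leq_mul2l; apply/orP; right; apply: leq_trans leZ.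
by rewrite (leq_trans (subset_leq_card (Ohm_sub 1 _))) // leq_pmull ?prime_gt0.
Qed.

Lemma card_leq_small_noncentral_even x : p = 2 -> ~~ (G \isog 'Q_8) ->
  x \in G -> x \notin Z -> x ^+ 4 = 1 -> #|G| <= p ^ (2 * k + 2).
Proof.
move=> p2 nQ8 Gx nZx x4; have lt2q : 2 < p ^ 2 by rewrite p2.
have xq : x ^+ (p ^ 2) = 1 by rewrite p2.
have [leG leZ] := card_leq_Ohm1_center lt2q Gx nZx xq.
move: pG leC_order leG leZ; rewrite p2 => pG2 leCo leG leZ.
have pZ := pgroupS (center_sub G) pG2.
rewrite addnS expnS leq_pmul2l // in leZ.
rewrite leqNgt; apply/negP=> ltG; case/negP: nQ8.
have ltOhm: 2 ^ k < #|'Ohm_1(Z)|.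
  rewrite -(ltn_pmul2l (expn_gt0 2 (k + 2))) (leq_trans _ leG) //.
  by rewrite -expnD (_ : k + 2 + k = 2 * k + 2)%N //; lia.
(* A proper subgroup of Z has order at most |Z| / 2 <= 2^k. Hence Omega_1(Z) is all of Z. *)
have small (H : {group gT}) z : H \subset Z -> 2 ^ k < #|H| -> z \in Z -> z \in H.
  move=> sHZ ltH Zz; apply: contraLR ltH => nHz; rewrite -leqNgt.
  rewrite -(leq_pmul2l (isT : 0 < 2)) -expnS -(addn1 k).
  apply: leq_trans leZ; exact: leq_card_pgroup_proper pZ sHZ Zz nHz.
have Zsqr z : z \in Z -> z ^+ 2 = 1.
  move/(small _ _ (Ohm_sub 1 _) ltOhm).
  rewrite /= (OhmEabelian pZ) ?(abelianS (Ohm_sub _ _)) ?center_abelian //.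
  by case/setIP=> _; rewrite inE => /eqP.
have ltZ: 2 ^ k < #|Z| := leq_trans ltOhm (subset_leq_card (Ohm_sub 1 _)).
have oZ: #|Z| = (2 ^ k.+1)%N.
  have [u oZ] := p_natP pZ; move: ltZ leZ.
  rewrite oZ ltn_exp2l // leq_exp2l // addn1 => ltku leuk.
  by congr (2 ^ _)%N; apply/eqP; rewrite eqn_leq leuk.
have sqr_central y : y \in G -> y ^+ 2 = 1 -> y \in Z.
  move=> Gy y2; apply: contraLR ltZ => nZy; rewrite -leqNgt.
  rewrite -(leq_pmul2l (isT : 0 < 2)) [X in _ <= X]mulnC.
  exact: leq_trans (leq_card_cent1 pG2 Gy nZy) (leCo _ _ Gy nZy y2 isT).
(* Z is elementary abelian, so y^4 = 1 and |C(y)| <= 4 2^k = 2 |Z|. *)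
have leC4 y : y \in G -> y \notin Z -> y ^+ 2 \in Z -> #|'C_G[y]| <= 2 * #|Z|.
  move=> Gy nZy Zy2; rewrite oZ -expnS -(addn2 k) expnD.
  by apply: leCo => //; rewrite (expgM y 2 2) Zsqr.
(* Otherwise the last noncentral y^(2^i) would have a centralizer of order at least 4 |Z|. *)
have sqrZ y : y \in G -> y ^+ 2 \in Z.
  move=> Gy; have [Zy | nZy] := boolP (y \in Z); first by rewrite groupX.
  have [i [nZt Zt2]] := last_noncentral_expg pG2 Gy nZy.
  have Gt : y ^+ (2 ^ i) \in G by rewrite groupX.
  have Cy : y \in 'C_G[y ^+ (2 ^ i)] by rewrite inE Gy; apply/cent1P/commuteX.
  apply: contraLR (leC4 _ Gt nZt Zt2) => nZy2; rewrite -ltnNge.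
  apply: leq_trans (leq_card_cent1_sqr pG2 Gt nZt Zt2 Cy nZy2).
  by rewrite ltn_pmul2l // ltn_Pmull ?cardG_gt0.
have leGZ : 2 * #|Z| ^ 2 <= #|G|.
  have [v oG] := p_natP pG2; move: ltG.
  by rewrite oG oZ -expnM -expnS ltn_exp2l // leq_exp2l // => ltv; lia.
have class_sub y : y \in G -> y ^: G \subset y *: Z.
  move=> Gy; apply/subsetP=> _ /imsetP[t Gt ->].
  by rewrite mem_lcoset -commgEl; apply: (@commg_sqr_mem _ G 'Z(G)%G).
have leclass y : y \in G -> y \notin Z -> #|G| <= 2 * #|Z| * #|y ^: G|.
  move=> Gy nZy; rewrite -(Lagrange (subsetIl G 'C[y])) index_cent1.
  by rewrite leq_mul2r leC4 ?sqrZ ?orbT.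
have classE y : y \in G -> y \notin Z -> y ^: G = y *: Z.
  (* The class lies in y Z and has at least |G| / (2 |Z|) >= |Z| elements. *)
  move=> Gy nZy; apply/eqP; rewrite eqEcard class_sub //= card_lcoset.
  rewrite -(leq_pmul2l (_ : 0 < 2 * #|Z|)) ?muln_gt0 ?cardG_gt0 //.
  by rewrite (leq_trans _ (leclass y Gy nZy)) // -mulnA.
have oG : #|G| = (2 * #|Z| ^ 2)%N.
  apply/eqP; rewrite eqn_leq leGZ andbT -{1}[2]/(1 + 1)%N.
  by have:= leclass x Gx nZx; rewrite classE // card_lcoset -mulnA.
apply: isog_Q8_sqr => // y z Gy nZy Zz.
have: y * z \in y ^: G by rewrite classE // mem_lcoset mulKg.
by case/imsetP=> t Gt eqt; exists t => //; rewrite commgEl -eqt mulKg.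
Qed.

End SmallNoncentral.

(** * The bound in terms of [mci] *)

Lemma card_cent1_leq_mci (gT : finGroupType) (G : {group gT}) g :
  g \in G -> g \notin 'Z(G) -> #|'C_G[g]| <= mci G * #[g].
Proof.
move=> Gg nZg.
have sgC : <[g]> \subset 'C_G[g] by rewrite cycle_subG inE Gg cent1id.
rewrite -(Lagrange sgC) mulnC leq_mul2r /mci; apply/orP; right.
by rewrite (bigD1 g) ?leq_maxl //= inE nZg.
Qed.

Lemma card_leq_mci (p : nat) (gT : finGroupType) (G : {group gT}) k :
    prime p -> p.-group G -> ~~ abelian G -> mci G = (p ^ k)%N ->
  ~~ (G \isog 'Q_8) -> #|G| <= p ^ (2 * k + 2).
Proof.
move=> p_pr pG nabG mciG nQ8.
have leC g : g \in G -> g \notin 'Z(G) -> #|'C_G[g]| <= p ^ k * #[g].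
  by rewrite -mciG; apply: card_cent1_leq_mci.
(* The least [n] with p^n > 2. *)
pose n : nat := (if p == 2 then 2 else 1)%N.
have lt2q : 2 < p ^ n.
  rewrite /n; case: eqP => [-> // | p_neq2]; rewrite expn1.
  by rewrite ltn_neqAle eq_sym prime_gt1 // andbT; apply/eqP.
have [/forall_inP small | ] := boolP [forall x in G, (x ^+ (p ^ n) == 1) ==> (x \in 'Z(G))].
  apply: (card_leq_small_central p_pr pG lt2q) => // x Gx xn.
  by apply: (implyP (small x Gx)); rewrite xn.
case/forall_inPn=> x Gx; rewrite negb_imply => /andP[/eqP xn nZx].
move: xn; rewrite /n; case: eqP => [p2 | p_neq2].
  move=> xn; have x4 : x ^+ 4 = 1 by rewrite -[RHS]xn p2.
  exact: (card_leq_small_noncentral_even p_pr pG nabG leC p2 nQ8 Gx nZx x4).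
have odd_p : odd p by have [] := even_prime p_pr.
rewrite expn1 => xp; exact: (card_leq_small_noncentral_odd p_pr pG leC odd_p Gx nZx xp).
Qed.

(** * The semidirect products that attain the bound *)

Section TwistedPlane.

Import GRing.Theory.
Local Open Scope ring_scope.

Variables (R : finComNzRingType) (r : R).

(* The argument r * r = 0, which makes [twisted_mul] associative, is phantom: it
   carries the hypothesis needed by the group structure. *)
Definition twisted_plane of r * r = 0 := (R * R)%type.

Hypothesis r2 : r * r = 0.
Local Notation T := (twisted_plane r2).

HB.instance Definition _ := Finite.on T.

(** The semidirect product of R by R in which b acts as multiplication by 1 + r b; as r^2 = 0, this
    turns sums into products. *)
Definition twisted_mul (x y : T) : T := (x.1 + y.1 + r * x.2 * y.1, x.2 + y.2).
Definition twisted_inv (x : T) : T := (r * x.2 * x.1 - x.1, - x.2).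
Definition twisted_one : T := (0, 0).

Fact twisted_mulA : associative twisted_mul.
Proof.
move=> [a b] [c d] [e f]; rewrite /twisted_mul /=; congr (_, _); last exact: addrA.
apply/eqP; rewrite -subr_eq0; apply/eqP.
transitivity ((r * r) * (b * d * e)); last by rewrite r2 mul0r.
by ring.
Qed.

Fact twisted_mul1 : left_id twisted_one twisted_mul.
Proof. by case=> a b; rewrite /twisted_mul /= mulr0 mul0r addr0 !add0r. Qed.

Fact twisted_mulV : left_inverse twisted_one twisted_inv twisted_mul.
Proof. by case=> a b; congr (_, _); rewrite /=; ring. Qed.

HB.instance Definition _ :=
  Finite_isGroup.Build T twisted_mulA twisted_mul1 twisted_mulV.

Lemma twisted_mulE (x y : T) : (x * y)%g = (x.1 + y.1 + r * x.2 * y.1, x.2 + y.2).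
Proof. by []. Qed.

Lemma twisted_commuteE (x y : T) :
  commute x y <-> r * x.2 * y.1 = r * y.2 * x.1.
Proof.
rewrite /commute !twisted_mulE; split=> [[] | eqr].
  by rewrite [y.1 + _]addrC => /addrI.
by rewrite [y.1 + _]addrC [y.2 + _]addrC eqr.
Qed.

Lemma twisted_centerP (x : T) :
  reflect (r * x.1 = 0 /\ r * x.2 = 0) (x \in 'Z([set: T])).
Proof.
apply: (iffP (centerP _ _)) => [[_ cx] | [r1 r2x]].
  split.
    have /twisted_commuteE/= := cx (0, 1) (in_setT _).
    by rewrite mulr0 mulr1 => <-.
  have /twisted_commuteE/= := cx (1, 0) (in_setT _).
  by rewrite !mulr1 mulr0 mul0r.
split=> [|y _]; first exact: in_setT.
by apply/twisted_commuteE; rewrite r2x mul0r mulrAC r1 mul0r.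
Qed.

Lemma twisted_expg (x : T) n :
  (x ^+ n)%g = (x.1 *+ n + (r * x.1 * x.2) *+ 'C(n, 2), x.2 *+ n).
Proof.
elim: n => [|n IHn]; first by rewrite expg0 !mulr0n addr0.
rewrite expgS IHn twisted_mulE /=; congr (_, _); last by rewrite mulrS.
have sq0 : r * x.2 * (r * x.1 * x.2) = 0.
  by rewrite (_ : _ * _ = r * r * (x.1 * x.2 * x.2)); [rewrite r2 mul0r | ring].
rewrite mulrDr !mulrnAr sq0 mul0rn addr0 binS bin1 mulrnDr mulrS -!addrA.
by rewrite (mulrAC r x.2).
Qed.

(** The second coordinate of x^n is r x.2. Once it is 0, the binomial term of the first coordinate
    vanishes and leaves r x.1 = 0. *)
Lemma twisted_expg_eq1_center (x : T) n :
  r = n%:R -> (x ^+ n)%g = 1%g -> x \in 'Z([set: T]).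
Proof.
move=> rn xn.
have oneE : (1%g : T) = (0, 0) :> R * R by [].
have eq2 : r * x.2 = 0.
  by have := congr1 snd xn; rewrite twisted_expg oneE /= -mulr_natl -rn.
have eq1 : r * x.1 = 0.
  have := congr1 fst xn; rewrite twisted_expg oneE /= -(mulr_natl x.1) -rn.
  by rewrite mulrAC eq2 mul0r mul0rn addr0.
exact/twisted_centerP.
Qed.

End TwistedPlane.

(* Only mci G <= p^k is computed; the converse is [card_leq_mci]. *)
Lemma mci_eq_of_large_order (gT : finGroupType) (G : {group gT}) (p k : nat) :
    prime p -> #|G| = (p ^ (2 * k + 2))%N -> ~~ abelian G ->
    (forall g, g \in G -> g \notin 'Z(G) -> g ^+ (p ^ k) != 1) ->
  mci G = (p ^ k)%N.
Proof.
move=> p_pr oG nabG large_order; have p_gt1 := prime_gt1 p_pr.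
have pG : p.-group G by rewrite /pgroup oG pnatX pnat_id.
have le_order g : g \in G -> g \notin 'Z(G) -> p ^ k.+1 <= #[g].
  move=> Gg nZg; have [j oj] := p_natP (mem_p_elt pG Gg).
  rewrite oj leq_exp2l // ltnNge; apply: contra (large_order g Gg nZg) => le_jk.
  by rewrite -order_dvdn oj dvdn_exp2l.
have le_index g : g \in G :\: 'Z(G) -> #|'C_G[g] : <[g]>| <= p ^ k.
  case/setDP=> Gg nZg.
  have sgC : <[g]> \subset 'C_G[g] by rewrite cycle_subG inE Gg cent1id.
  (* C(g) is proper in G, so its order is at most p^(2k+1), while [g] has order at least p^(k+1). *)
  have [x Gx nCx] : exists2 x, x \in G & x \notin 'C_G[g].
    apply/subsetPn; apply: contra nZg; rewrite subsetI => /andP[_ sGC].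
    by rewrite inE Gg -sub_cent1.
  have := leq_card_pgroup_proper pG (subsetIl G 'C[g]) Gx nCx.
  rewrite -(Lagrange sgC) -orderE oG mul2n -addnn addn2 -addSn -addSn.
  rewrite expnD expnS -mulnA leq_pmul2l ?prime_gt0 // => leG.
  rewrite -(leq_pmul2l (_ : 0 < p ^ k.+1)) ?expn_gt0 ?prime_gt0 //.
  by rewrite (leq_trans _ leG) // leq_mul2r le_order ?orbT.
have ntD : 0 < #|G :\: 'Z(G)|.
  rewrite card_gt0 setD_eq0; apply: contra nabG => sGZ.
  exact: abelianS sGZ (center_abelian G).
have [g Dg mciE] : {g | g \in G :\: 'Z(G) & mci G = #|'C_G[g] : <[g]>|}.
  exact: eq_bigmax_cond.
have [k' oCg] : {k' | #|'C_G[g] : <[g]>| = (p ^ k')%N}.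
  by apply/p_natP/(pnat_dvd (dvdn_indexg _ _))/(pgroupS (subsetIl _ _) pG).
rewrite mciE; apply/eqP; rewrite eqn_leq le_index //= oCg leq_exp2l //.
(* |G| is a square and 8 is not. *)
have nQ8 : ~~ (G \isog 'Q_8).
  apply/negP=> /card_isog; rewrite oG (@card_quaternion 3) //.
  rewrite (_ : 2 * k + 2 = k.+1 * 2)%N; last by rewrite mulnC mulSn addnC.
  rewrite expnM; case: (p ^ k.+1)%N => [|[|[|q]]] // eq8.
  by have := leq_exp2r 3 q.+3 (isT : 0 < 2); rewrite eq8.
have := card_leq_mci p_pr pG nabG (etrans mciE oCg) nQ8.
by rewrite oG leq_exp2l // leq_add2r leq_pmul2l.
Qed.

Lemma twisted_plane_mci (p k : nat) (r : 'Z_(p ^ k.+1)) (r2 : (r * r = 0)%R)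
    (G := [set: twisted_plane r2]%G) :
    prime p -> 0 < k -> r = ((p ^ k)%:R)%R ->
  [/\ p.-group G, ~~ abelian G, mci G = (p ^ k)%N & #|G| = (p ^ (2 * k + 2))%N].
Proof.
move=> p_pr k_gt0 rE; set q := (p ^ k.+1)%N in r r2 @G rE *.
have p_gt1 := prime_gt1 p_pr.
have q_gt1 : 1 < q by rewrite -(exp1n k.+1) ltn_exp2r.
have r_neq0 : (r != 0)%R.
  rewrite rE -val_eqE /= val_Zp_nat // -/(_ %| _) gtnNdvd ?expn_gt0 ?prime_gt0 //.
  by rewrite ltn_exp2l.
have oG : #|G| = (p ^ (2 * k + 2))%N.
  rewrite cardsT [LHS]card_prod card_ord Zp_cast // -expnD addnn -mul2n.
  by rewrite mulnS addnC.
have nZ01 : ((0, 1)%R : twisted_plane r2) \notin 'Z(G).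
  by apply/twisted_centerP=> -[_] /=; rewrite GRing.mulr1; apply/eqP.
have nabG : ~~ abelian G.
  apply: contra nZ01 => abG; apply: (subsetP (_ : G \subset 'Z(G))).
    by rewrite subsetI subxx.
  exact: in_setT.
split=> //; first by rewrite /pgroup oG pnatX pnat_id.
apply: mci_eq_of_large_order => // g _; apply: contra => /eqP.
exact: twisted_expg_eq1_center.
Qed.

Lemma mci_bound_attained (p k : nat) : prime p -> 0 < k ->
  exists (gT : finGroupType) (G : {group gT}),
    [/\ p.-group G, ~~ abelian G, mci G = (p ^ k)%N & #|G| = (p ^ (2 * k + 2))%N].
Proof.
move=> p_pr k_gt0; pose r : 'Z_(p ^ k.+1) := ((p ^ k)%:R)%R.
have q_gt1 : 1 < p ^ k.+1 by rewrite -(exp1n k.+1) ltn_exp2r // prime_gt1.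
have r2 : (r * r = 0)%R.
  apply/eqP; rewrite -GRing.natrM -val_eqE /= val_Zp_nat // -expnD.
  (* k + 1 <= 2k because k > 0. *)
  by apply: dvdn_exp2l; rewrite -addn1 leq_add2l.
by have := twisted_plane_mci r2 p_pr k_gt0 (erefl r); eexists; eexists; eassumption.
Qed.

(** Best possible is read as attained for every prime and every k > 0. For k = 0 equality cannot
    occur, since groups of order p^2 are abelian. *)
Theorem theoremA (p : nat) (p_pr : prime p) :
  (forall (gT : finGroupType) (G : {group gT}) (k : nat),
     p.-group G -> ~~ abelian G -> mci G = (p ^ k)%N ->
     ~~ (G \isog 'Q_8) -> (#|G| <= p ^ (2 * k + 2))%N)
  /\
  (forall k : nat, (0 < k)%N ->
     exists (gT : finGroupType) (G : {group gT}),
       [/\ p.-group G, ~~ abelian G, mci G = (p ^ k)%N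
         & #|G| = (p ^ (2 * k + 2))%N]).
Proof.
split=> [gT G k | k]; first exact: card_leq_mci.
exact: mci_bound_attained.
Qed.
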